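(* For every integer $n \geq 1$, the Kirchhoff index of the linear crossed octagonal-quadrilateral network $Q_n$ is $$Kf(Q_n) = \frac{32n^{3}+44n^{2}+17n+2}{3}.$$
   Context: Definition of $Q_n$ (for an integer $n\ge 1$). The linear crossed octagonal-quadrilateral network $Q_n$ is the simple undirected graph with the $8n+2$ vertices $1,2,\ldots,4n+1$ and $1',2',\ldots,(4n+1)'$, and exactly the following $18n+1$ edges: (i) $\{i,i+1\}$ and $\{i',(i+1)'\}$ for $1\le i\le 4n$; (ii) the crossing edges $\{i,(i+1)'\}$ and $\{i',i+1\}$ for $1\le i\le 4n$; (iii) the rungs $\{1,1'\}$, and $\{4k,(4k)'\}$ and $\{4k+1,(4k+1)'\}$ for $1\le k\le n$. Kirchhoff index. For a simple connected graph $G$ with vertices $v_1,\ldots,v_N$, the resistance distance $r_{ij}$ between $v_i$ and $v_j$ is the effective resistance between $v_i$ and $v_j$ in the electrical network obtained from $G$ by placing a unit resistor on each edge. The Kirchhoff index is $Kf(G)=\sum_{i<j} r_{ij}$. *)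

(* Defs.v *)
From HB Require Import structures.
From mathcomp Require Import all_boot all_order all_algebra.
From mathcomp Require Import boolp classical_sets reals.
From mathcomp Require Import ring lra zify.
Set Implicit Arguments.
Unset Strict Implicit.
Unset Printing Implicit Defensive.
Import Order.TTheory GRing.Theory Num.Theory.
Local Open Scope ring_scope.

Record sgraph := SGraph {
  vertex :> finType;
  adj : rel vertex;
  adj_sym : symmetric adj;
  adj_irrefl : irreflexive adj }.

Definition connected_graph (G : sgraph) : Prop :=
  forall x y : G, connect (@adj G) x y.

Section Resistance.
Variables (R : realType) (G : sgraph).
Implicit Types (i j k l : G) (v : G -> R).

(* With a unit resistor on each edge, Ohm's law makes [v k - v l] the current
   along the edge from k to l. Kirchhoff's current law then says that a unit
   current enters the network at i and leaves it at j. *)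
Definition unit_current_potential i j v : Prop :=
  forall k, \sum_(l | adj k l) (v k - v l) = (k == i)%:R - (k == j)%:R.

Definition effective_resistance i j (r : R) : Prop :=
  exists2 v, unit_current_potential i j v & r = v i - v j.

(* The default value 0 is irrelevant for a connected graph: see
   [resistanceP] and [effective_resistance_inj] below. *)
Definition resistance i j : R :=
  xget 0 [set r | effective_resistance i j r]%classic.

(* The vertices v_1, ..., v_N are [enum_val 0], ..., [enum_val (N - 1)]. *)
Definition kirchhoff_index : R :=
  \sum_(a < #|G|) \sum_(b < #|G| | (a < b)%N)
    resistance (enum_val a) (enum_val b).

Lemma dirichlet_energy v :
  \sum_k v k * (\sum_(l | adj k l) (v k - v l)) *+ 2 =
  \sum_k \sum_(l | adj k l) (v k - v l) ^+ 2.
Proof.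
have E : \sum_k v k * (\sum_(l | adj k l) (v k - v l)) =
         \sum_k \sum_(l | adj k l) v k * (v k - v l).
  by apply: eq_bigr => k _; rewrite mulr_sumr.
rewrite sumrMnl E mulr2n {2}(exchange_big_dep xpredT) //= -big_split /=.
apply: eq_bigr => k _.
rewrite [X in _ + X](eq_bigl (fun l => adj k l)); last first.
  by move=> l; rewrite adj_sym.
rewrite -big_split /=; apply: eq_bigr => l _.
by rewrite -[v l - v k]opprB mulrN -mulrBl expr2.
Qed.

Lemma zero_energy_const v : connected_graph G ->
  \sum_k \sum_(l | adj k l) (v k - v l) ^+ 2 = 0 -> forall x y, v x = v y.
Proof.
move=> Gc E0 x y.
have e_adj k l : adj k l -> v k = v l.
  move=> kl; apply/eqP; rewrite -subr_eq0 -sqrf_eq0.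
  have /psumr_eq0P H := E0.
  have {H} Hk := H (fun k _ => sumr_ge0 _ (fun l _ => sqr_ge0 _)) k isT.
  by have /psumr_eq0P -> := Hk => // m _; exact: sqr_ge0.
have /connectP[p] := Gc x y.
elim: p x => [x _ ->//|z p IH x /= /andP[xz zp] yl].
by rewrite (e_adj _ _ xz) (IH z).
Qed.

Lemma effective_resistance_inj i j r s : connected_graph G ->
  effective_resistance i j r -> effective_resistance i j s -> r = s.
Proof.
move=> Gc [v Hv ->] [w Hw ->]; pose u k := v k - w k.
have Hu k : \sum_(l | adj k l) (u k - u l) = 0.
  rewrite (eq_bigr (fun l => (v k - v l) - (w k - w l))); last first.
    by move=> l _; rewrite /u; ring.
  by rewrite sumrB Hv Hw subrr.
have : u i = u j.
  apply: zero_energy_const => //; rewrite -dirichlet_energy.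
  by apply: big1 => k _; rewrite Hu mulr0 mul0rn.
by rewrite /u; lra.
Qed.

Let shifted_laplacian (u : {ffun G -> R^o}) : {ffun G -> R^o} :=
  [ffun k => \sum_(l | adj k l) (u k - u l) + \sum_l u l].

Let shifted_laplacian_linear : linear shifted_laplacian.
Proof.
move=> c u v; apply/ffunP => k; rewrite !ffunE.
rewrite scalerDr !scaler_sumr addrACA -!big_split /=.
by congr (_ + _); apply: eq_bigr => l _; rewrite !ffunE // /GRing.scale /=; ring.
Qed.

Lemma effective_resistance_ex i j : connected_graph G ->
  exists r, effective_resistance i j r.
Proof.
move=> Gc; pose f := shifted_laplacian.
pose fA := GRing.isLinear.Build _ _ _ _ f shifted_laplacian_linear.
pose fL : {linear {ffun G -> R^o} -> {ffun G -> R^o}} := HB.pack f fA.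
have N0 : #|G|%:R != 0 :> R by rewrite pnatr_eq0 -lt0n; apply/card_gt0P; exists i.
have ker0 : lker (linfun fL) == 0%VS.
  apply/lker0P => u v; rewrite !lfunE => fuv.
  apply/eqP; rewrite -subr_eq0; apply/eqP.
  have : fL (u - v) = 0 by rewrite (linearB fL); apply/eqP; rewrite subr_eq0; apply/eqP.
  move: (u - v) => {u v fuv}u fu0.
  have S : \sum_k \sum_(l | adj k l) (u k - u l) ^+ 2 + (\sum_l u l) ^+ 2 *+ 2 = 0.
    rewrite -dirichlet_energy expr2 mulr_suml -sumrMnl -big_split /=.
    apply: big1 => k _; rewrite -mulrnDl -mulrDr.
    have := congr1 (fun g : {ffun G -> R^o} => g k) fu0.
    by rewrite !ffunE => ->; rewrite mulr0 mul0rn.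
  have E0 : 0 <= \sum_k \sum_(l | adj k l) (u k - u l) ^+ 2.
    by apply: sumr_ge0 => k _; apply: sumr_ge0 => l _; exact: sqr_ge0.
  have S0 := sqr_ge0 (\sum_l u l).
  have cst := zero_energy_const Gc (v := u) ltac:(lra).
  have /eqP : (\sum_l u l) ^+ 2 = 0 by lra.
  rewrite sqrf_eq0 => /eqP sum0; apply/ffunP => k; rewrite ffunE.
  move: sum0; rewrite (eq_bigr (fun=> u k)) => [|l _]; last exact: cst.
  rewrite sumr_const -[in X in X = _]mulr_natr => /eqP.
  by rewrite mulf_eq0 (negPf N0) orbF => /eqP.
pose b : {ffun G -> R^o} := [ffun k => (k == i)%:R - (k == j)%:R].
pose v := ((linfun fL)^-1)%VF b.
have fvE k : \sum_(l | adj k l) (v k - v l) + \sum_l v l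
    = (k == i)%:R - (k == j)%:R.
  have := lker0_lfunVK ker0 b; rewrite lfunE /= -/v => vb.
  by have := congr1 (fun g : {ffun G -> R^o} => g k) vb; rewrite !ffunE.
have sum1 x : \sum_(k : G) (k == x)%:R = 1 :> R.
  by rewrite (bigD1 x) //= eqxx big1 ?addr0 // => k /negPf ->.
have lap0 : \sum_k \sum_(l | adj k l) (v k - v l) = 0.
  have E : \sum_k \sum_(l | adj k l) (v k - v l) =
      \sum_k \sum_(l | adj k l) (v l - v k).
    rewrite (exchange_big_dep xpredT) //=; apply: eq_bigr => k _.
    by apply: eq_bigl => l; rewrite adj_sym.
  have : \sum_k \sum_(l | adj k l) (v k - v l) +
      \sum_k \sum_(l | adj k l) (v l - v k) = 0.
    rewrite -big_split big1 //= => k _; rewrite -big_split big1 //= => l _.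
    by ring.
  by rewrite -E; lra.
have sumv0 : \sum_l v l = 0.
  have : \sum_k (\sum_(l | adj k l) (v k - v l) + \sum_l v l) = 0.
    by rewrite (eq_bigr _ (fun k _ => fvE k)) sumrB !sum1 subrr.
  rewrite big_split /= lap0 add0r sumr_const -[in X in X = _]mulr_natr => /eqP.
  by rewrite mulf_eq0 (negPf N0) orbF => /eqP.
by exists (v i - v j), v => // k; rewrite -fvE sumv0 addr0.
Qed.

Lemma resistanceP i j : connected_graph G ->
  effective_resistance i j (resistance i j).
Proof.
move=> /(effective_resistance_ex i j)[r Hr].
exact: (xgetPex 0 (ex_intro _ r Hr)).
Qed.

End Resistance.

(* Vertices of Q_n: [(false, a)] and [(true, a)] stand for the vertices a + 1
   and (a + 1)', since ordinals are numbered from 0. *)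
Definition Q_vertex n : finType := (bool * 'I_(4 * n).+1)%type.

Definition label n (x : Q_vertex n) : nat := x.2.+1.

Definition consecutive (a b : nat) : bool := (b == a.+1) || (a == b.+1).

Definition rung n (a : nat) : bool :=
  (a == 1%N) || has (fun k => (a == 4 * k)%N || (a == (4 * k).+1)%N) (iota 1 n).

Definition Q_adj n : rel (Q_vertex n) := fun x y =>
  [|| (x.1 == y.1) && consecutive (label x) (label y),
      (x.1 != y.1) && consecutive (label x) (label y)
    | [&& x.1 != y.1, label x == label y & rung n (label x)]].

Lemma Q_adj_sym n : symmetric (@Q_adj n).
Proof.
move=> x y; rewrite /Q_adj /consecutive ![y.1 == _]eq_sym.
rewrite ![(label y == (label x).+1) || _]orbC [label y == label x]eq_sym.
by case: (label x =P label y) => [->|]; rewrite ?andbF.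
Qed.

Lemma Q_adj_irrefl n : irreflexive (@Q_adj n).
Proof.
by move=> x; rewrite /Q_adj /consecutive eqxx orbb /= orbF (ltn_eqF (ltnSn _)).
Qed.

Definition Q n : sgraph := SGraph (@Q_adj_sym n) (@Q_adj_irrefl n).

Lemma card_Q n : #|Q n| = (8 * n + 2)%N.
Proof. by rewrite card_prod card_bool card_ord; lia. Qed.

Lemma Q_connected n : connected_graph (Q n).
Proof.
have csym : connect_sym (@adj (Q n)).
  exact/sym_connect_sym/Q_adj_sym.
suff to0 (x : Q n) : connect (@adj (Q n)) x (false, ord0).
  by move=> x y; apply: connect_trans (to0 x) _; rewrite csym.
case: x => b [a]; elim: a => [|a IH] lt_a.
  case: b; last by rewrite (_ : Ordinal lt_a = ord0) //; exact: val_inj.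
  exact: connect1.
apply: connect_trans (IH (ltnW lt_a)); apply: connect1.
by rewrite /= /Q_adj /consecutive /label /= !eqxx orbT.
Qed.

(* Main.v *)
Require Import Defs.
From mathcomp Require Import all_boot all_order all_algebra.
From mathcomp Require Import reals.
From mathcomp Require Import ring lra zify.
Import GRing.Theory Num.Theory.
Local Open Scope ring_scope.

(** Swapping the two vertices of a single column (a, a') is an automorphism of
    Q_n, because consecutive columns are completely joined. Every potential
    therefore splits, column by column, into an even part (equal values on a
    and a') and an odd part (opposite values), and the Laplacian respects the
    splitting:
    - on even potentials it is twice the Laplacian of a path, since each
      vertex sees both vertices of each neighbouring column;
    - on odd potentials it is diagonal, because the two contributions of a
      neighbouring column cancel; the eigenvalue of a column is
      [odd_eigenvalue].

    A unit current entering at a single vertex of a column is the sum of an even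
    source (1/2, 1/2) and an odd source (1/2, -1/2) on that column, and both
    can be solved explicitly. With m
    the eigenvalue of the column of x, the function
      g x y = - |col x - col y| / 8 + s / (2 m),
    where s is 1 if y = x, -1 if y is the other vertex of the column of x, and
    0 otherwise, has Laplacian delta_x up to a term that is independent of x
    ([Q_green_laplacian]). That term disappears in g x - g y, the potential of
    a unit current from x to y, and summing the resulting resistances
    g x x + g y y - g x y - g y x over all pairs expresses the Kirchhoff index
    as N * sum_x g x x - sum_(x, y) g x y, where N is the number of vertices
    ([kirchhoff_index_green]).

    The odd parts cancel in the double sum, which is thus a sum of distances
    on a path with 4n + 1 vertices ([sum_distances]). The diagonal sum is the
    sum of the inverses of the odd eigenvalues ([sum_inv_odd_eigenvalue]). *)

(** * Resistance and Green functions *)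

(** Any solution of Kirchhoff's equations computes the resistance: two
    solutions on a connected graph differ by a constant. *)
Lemma resistanceE (R : realType) (G : sgraph) (Gc : connected_graph G)
    (i j : G) (v : G -> R) :
  unit_current_potential i j v -> resistance R i j = v i - v j.
Proof.
move=> Hv; apply: (effective_resistance_inj Gc (resistanceP R i j Gc)).
by exists v.
Qed.

Lemma resistancexx (R : realType) (G : sgraph) (Gc : connected_graph G)
    (i : G) : resistance R i i = 0.
Proof.
rewrite (@resistanceE _ _ Gc i i (fun=> 0)) ?subrr // => k.
by rewrite [RHS]subrr big1 // => l _; rewrite subrr.
Qed.

Lemma resistance_sym (R : realType) (G : sgraph) (Gc : connected_graph G)
    (i j : G) : resistance R i j = resistance R j i.
Proof.
have [v Hv ->] := resistanceP R i j Gc.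
rewrite (@resistanceE _ _ Gc j i (fun k => - v k)); first by ring.
move=> k; rewrite -[RHS]opprB -Hv -sumrN.
by apply: eq_bigr => l _; ring.
Qed.

Lemma kirchhoff_index_ordered_pairs (R : realType) (G : sgraph)
    (Gc : connected_graph G) :
  \sum_(i : G) \sum_(j : G) resistance R i j = kirchhoff_index R G *+ 2.
Proof.
have sumE (F : G -> R) : \sum_i F i = \sum_(a < #|G|) F (enum_val a).
  by rewrite -(@big_enum_val _ _ _ _ (mem G)).
rewrite sumE (eq_bigr _ (fun a _ => sumE _)) mulr2n.
have swap : kirchhoff_index R G = \sum_(a < #|G|) \sum_(b < #|G| | (b < a)%N)
    resistance R (enum_val a) (enum_val b).
  rewrite /kirchhoff_index (exchange_big_dep xpredT) //=.
  apply: eq_bigr => a _; apply: eq_bigr => b _; exact: resistance_sym.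
rewrite {1}swap /kirchhoff_index -big_split /=; apply: eq_bigr => a _.
rewrite (bigID (fun b : 'I__ => (b < a)%N)) /=; congr (_ + _).
rewrite (bigD1 a) ?ltnn //= resistancexx // add0r.
by apply: eq_bigl => b; rewrite -val_eqE /=; lia.
Qed.

(** On a finite graph delta_x is never a Laplacian, as Laplacians sum to 0.
    Hence the background term [c]: as it does not depend on the source [x], it
    cancels in g x - g y, which is the potential of a unit current from x to
    y. *)
Lemma kirchhoff_index_green (R : realType) (G : sgraph)
    (Gc : connected_graph G) (g : G -> G -> R) (c : G -> R) :
  (forall x k, \sum_(l | adj k l) (g x k - g x l) = (k == x)%:R - c k) ->
  kirchhoff_index R G = #|G|%:R * \sum_x g x x - \sum_x \sum_y g x y.
Proof.
move=> gP.
have rE x y : resistance R x y = (g x x + g y y) - (g x y + g y x).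
  rewrite (@resistanceE _ _ Gc x y (fun k => g x k - g y k)); first by ring.
  move=> k; rewrite (eq_bigr (fun l => (g x k - g x l) - (g y k - g y l))).
    by rewrite sumrB !gP; ring.
  by move=> l _; ring.
have rowE x : \sum_y resistance R x y =
    (#|G|%:R * g x x + \sum_y g y y) - (\sum_y g x y + \sum_y g y x).
  rewrite (eq_bigr _ (fun y _ => rE x y)) sumrB !big_split /= sumr_const.
  by rewrite mulr_natl.
have := kirchhoff_index_ordered_pairs R _ Gc.
rewrite (eq_bigr _ (fun x _ => rowE x)) sumrB !big_split /= sumr_const.
rewrite -mulr_natl -mulr_sumr [X in _ - (_ + X)]exchange_big /= mulr2n.
lra.
Qed.

(** * The Laplacian of Q_n *)

(** The indices of [F] are natural numbers so that a neighbour of an end column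
    that does not exist can be written and given the coefficient 0. *)
Lemma sum_consecutive (R : realType) (n a : nat) (F : nat -> R) :
  (a <= n)%N ->
  \sum_(j < n.+1 | consecutive a.+1 j.+1) F j =
  (0 < a)%N%:R * F a.-1 + (a < n)%N%:R * F a.+1.
Proof.
move=> le_an.
rewrite (bigID (fun j : 'I__ => j == a.-1 :> nat)) /=; congr (_ + _).
  rewrite (eq_bigl (fun j : 'I_n.+1 => (0 < a)%N && (j == a.-1 :> nat))).
    rewrite (big_ord1_cond_eq _ F (fun=> 0 < a)%N) ltnS (leq_trans (leq_pred a)) //=.
    by case: ltnP => _; rewrite ?mul1r ?mul0r.
  by move=> j; rewrite /consecutive; lia.
rewrite (eq_bigl (fun j : 'I_n.+1 => (j == a.+1 :> nat))).
  rewrite big_ord1_eq ltnS.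
  by case: ltnP => _; rewrite ?mul1r ?mul0r.
by move=> j; rewrite /consecutive; lia.
Qed.

Lemma sum_Q_vertex (R : realType) (n : nat) (F : Q n -> R) :
  \sum_x F x = \sum_(a < (4 * n).+1) (F (true, a) + F (false, a)).
Proof.
rewrite big_split /=.
rewrite -(big_bool _ (fun b => \sum_(a < (4 * n).+1) F (b, a))).
by rewrite pair_bigA /=; apply: eq_bigr => -[].
Qed.

Lemma sum_Q_adj (R : realType) (n : nat) (x : Q n) (F : bool -> nat -> R) :
  \sum_(y | @adj (Q n) x y) F y.1 y.2 =
  (0 < x.2)%N%:R * (F true x.2.-1 + F false x.2.-1) +
  (x.2 < 4 * n)%N%:R * (F true x.2.+1 + F false x.2.+1) +
  (rung n x.2.+1)%:R * F (~~ x.1) x.2.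
Proof.
case: x => b a /=.
rewrite big_mkcond sum_Q_vertex /=.
rewrite -(sum_consecutive _ _ _ (fun j => F true j + F false j)); last first.
  by rewrite -ltnS.
have -> : (rung n a.+1)%:R * F (~~ b) a =
    \sum_(j < (4 * n).+1) if j == a then (rung n a.+1)%:R * F (~~ b) j else 0.
  by rewrite -big_mkcond big_pred1_eq.
rewrite [in RHS]big_mkcond -big_split /=; apply: eq_bigr => j _.
rewrite /Q_adj /label /= /consecutive [j == a]eq_sym -val_eqE eqSS /=.
have [->|ne] := (nat_of_ord a =P j).
  rewrite !(ltn_eqF (ltnSn _)) !andbF /= !add0r.
  by rewrite eqxx; case: rung; case: b; rewrite /= ?mul1r ?mul0r; ring.
have -> : (a.+1 == j.+1)%N = false by apply/eqP => -[].
by case: ((j == a.+1 :> nat) || _); case: b; rewrite /= ?orbF; ring.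
Qed.

(** The eigenvalue of the Laplacian on the potential equal to 1 at (false, a),
    to -1 at (true, a) and to 0 elsewhere: the degree of these two vertices,
    plus 1 when a rung joins them. *)
Definition odd_eigenvalue (n a : nat) : nat :=
  2 * ((0 < a)%N + (a < 4 * n)%N + rung n a.+1).

(** The even part [f] and the odd part [g] do not interact. *)
Lemma Q_laplacian (R : realType) (n : nat) (f g : nat -> R) (x : Q n) :
  let v (y : Q n) := f y.2 + (-1) ^+ y.1 * g y.2 in
  \sum_(y | @adj (Q n) x y) (v x - v y) =
  ((0 < x.2)%N%:R * (f x.2 - f x.2.-1) +
   (x.2 < 4 * n)%N%:R * (f x.2 - f x.2.+1)) *+ 2 +
  (-1) ^+ x.1 * ((odd_eigenvalue n x.2)%:R * g x.2).
Proof.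
move=> v; rewrite (sum_Q_adj _ _ _ (fun b a => v x - (f a + (-1) ^+ b * g a))).
rewrite /v /odd_eigenvalue natrM !natrD; case: x => -[] a /=; ring.
Qed.

(** * The Green function of Q_n *)

Definition Q_green (R : realType) (n : nat) (x y : Q n) : R :=
  - `|x.2%:R - y.2%:R| / 8 +
  (-1) ^+ y.1 * ((-1) ^+ x.1 * (y.2 == x.2)%:R / (2 * (odd_eigenvalue n x.2)%:R)).

Lemma odd_eigenvalue_gt0 (n a : nat) : (0 < odd_eigenvalue n a)%N.
Proof.
by rewrite /odd_eigenvalue; case: a => //; rewrite /rung; lia.
Qed.

(** The second difference of -|i - k| / 8 along the columns is concentrated at
    i, but for the missing outward neighbours of the two ends of the path. The
    outward slope there is -1 / 8 whatever i is, which makes the background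
    term independent of the source. *)
Lemma Q_green_laplacian (R : realType) (n : nat) (x k : Q n) :
  \sum_(l | @adj (Q n) k l) (Q_green R n x k - Q_green R n x l) =
  (k == x)%:R - ((k.2 == 0 :> nat)%:R + (k.2 == 4 * n :> nat)%N%:R) / 4.
Proof.
have -> := Q_laplacian R n (fun a => - `|x.2%:R - a%:R| / 8)
  (fun a => (-1) ^+ x.1 * (a == x.2)%:R / (2 * (odd_eigenvalue n x.2)%:R)) k.
have -> : (k == x) = (k.1 == x.1) && (k.2 == x.2 :> nat).
  by case: k x => ? ? [].
case: k x => b [k /= ltk] [c [i /= lti]].
have d0 : (odd_eigenvalue n i)%:R != 0 :> R.
  by rewrite pnatr_eq0 -lt0n odd_eigenvalue_gt0.
(* On odd potentials the Laplacian is diagonal: what is left is the odd part of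
   delta_x. *)
have -> : (-1) ^+ b * ((odd_eigenvalue n k)%:R * ((-1) ^+ c * (k == i)%:R /
    (2 * (odd_eigenvalue n i)%:R))) =
    (k == i)%:R * (-1) ^+ b * (-1) ^+ c / 2 :> R.
  by have [->|_] := eqVneq k i; [field | rewrite !(mul0r, mulr0, mul0rn)].
(* The Kronecker delta is the sum of its even and odd parts. *)
have -> : ((b == c) && (k == i))%:R =
    (k == i)%:R * (1 + (-1) ^+ b * (-1) ^+ c) / 2 :> R.
  by case: b; case: c; rewrite /= ?expr0 ?expr1; field.
suff : ((0 < k)%N%:R * (`|i%:R - k%:R| - `|i%:R - k.-1%:R|) +
   (k < 4 * n)%N%:R * (`|i%:R - k%:R| - `|i%:R - k.+1%:R|)) =
   ((k == 0)%:R + (k == 4 * n)%N%:R) - 2 * (k == i)%:R :> R.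
  by lra.
have [lt_ki|lt_ik|->] := ltngtP k i.
- have -> : (k < 4 * n)%N = true by lia.
  have -> : (k == 4 * n)%N = false by lia.
  have : k.+1%:R <= i%:R :> R by rewrite ler_nat.
  case: k {ltk} lt_ki => [|k] _ /=; rewrite -?natr1 => le_ki;
    rewrite !ger0_norm; lra.
- have -> : (0 < k)%N = true by lia.
  have -> : (k == 0)%N = false by lia.
  case: k {ltk} lt_ik (ltk) => [//|k] lt_ik ltk /=.
  have : i%:R <= k%:R :> R by rewrite ler_nat.
  have -> : (k.+1 == 4 * n)%N = ~~ (k.+1 < 4 * n)%N by lia.
  case: ltnP => _; rewrite -!natr1 => le_ki; rewrite !ler0_norm /=; lra.
- rewrite subrr normr0.
  have -> : (i == 4 * n)%N = ~~ (i < 4 * n)%N by lia.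
  rewrite -natr1 opprD addNKr normrN normr1.
  case: i {lti d0} => [|i] /=; case: ltnP => _ /=; rewrite -?natr1 ?addrK;
    rewrite ?[_ + 1 - _]addrC ?addKr ?normr1; lra.
Qed.

(** * The two sums *)

Lemma sum_distances (R : realType) (m : nat) :
  \sum_(i < m) \sum_(j < m) `|i%:R - j%:R| = (m%:R ^+ 3 - m%:R) / 3 :> R.
Proof.
have row k : \sum_(j < k) `|k%:R - j%:R| = k%:R * (k%:R + 1) / 2 :> R.
  elim: k => [|k IH]; first by rewrite big_ord0; ring.
  rewrite big_ord_recl /= subr0 ger0_norm //.
  under eq_bigr => j _ do
    rewrite /bump /= add1n -!natr1 opprD addrACA subrr addr0.
  by rewrite IH -natr1; field.
elim: m => [|m IH]; first by rewrite big_ord0; ring.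
rewrite big_ord_recr /= big_ord_recr /= subrr normr0 addr0 row.
under eq_bigr => i _ do rewrite big_ord_recr /= distrC.
rewrite big_split /= IH.
by rewrite (eq_bigr (fun i : 'I_m => `|m%:R - i%:R|)) ?row -?natr1 //; field.
Qed.

(** Column indices start at 0 and labels at 1, so the labels 4k and 4k + 1 are
    the residues 3 and 0. Label 1, the index 0, obeys the same rule. *)
Lemma rung_mod4 (n a : nat) : (a <= 4 * n)%N ->
  rung n a.+1 = (a %% 4 == 0)%N || (a %% 4 == 3)%N.
Proof.
move=> le_an; rewrite /rung; apply/idP/idP => [/orP[|/hasP[k _]]|]; try lia.
move=> a4; have [->//|a0] := eqVneq a 0%N.
apply/orP; right; apply/hasP; exists (a.+1 %/ 4)%N; last by lia.
by rewrite mem_iota; lia.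
Qed.

(** The inverse odd eigenvalues, as they would be if no column were an end:
    1 / 6 with a rung, 1 / 4 without. Each block of four columns has two of
    each. *)
Lemma sum_mod4_weight (R : realType) (n : nat) :
  \sum_(a < (4 * n).+1)
    (if (a %% 4 == 0)%N || (a %% 4 == 3)%N then 6^-1 else 4^-1) =
  (5 * n%:R + 1) / 6 :> R.
Proof.
elim: n => [|n IH]; first by rewrite big_ord1 /=; field.
rewrite (_ : (4 * n.+1).+1 = (4 * n).+1.+4) ?mulnS //.
rewrite 4!big_ord_recr /= IH.
rewrite (_ : (4 * n).+1 %% 4 = 1)%N; last lia.
rewrite (_ : (4 * n).+2 %% 4 = 2)%N; last lia.
rewrite (_ : (4 * n).+3 %% 4 = 3)%N; last lia.
rewrite (_ : (4 * n).+4 %% 4 = 0)%N; last lia.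
by rewrite /= -natr1; field.
Qed.

(** Each of the two end columns carries a rung but has only one neighbour, so
    that its inverse eigenvalue is 1 / 4, that is 1 / 12 more than the value
    1 / 6 of an inner rung. They are distinct because n >= 1. *)
Lemma sum_inv_odd_eigenvalue (R : realType) (n : nat) : (1 <= n)%N ->
  \sum_(a < (4 * n).+1) (odd_eigenvalue n a)%:R^-1 =
  (5 * n%:R + 2) / 6 :> R.
Proof.
move=> n1.
have wE (a : 'I_(4 * n).+1) : (odd_eigenvalue n a)%:R^-1 =
    (if (a %% 4 == 0)%N || (a %% 4 == 3)%N then 6^-1 else 4^-1) +
    ((if a == 0%N :> nat then 12^-1 else 0) +
     (if a == (4 * n)%N :> nat then 12^-1 else 0)) :> R.
  case: a => a /=; rewrite ltnS => le_an.
  rewrite /odd_eigenvalue rung_mod4 //.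
  have [->|a0] := eqVneq a 0%N.
    have -> : (0 == 4 * n)%N = false by lia.
    have -> : (0 < 4 * n)%N by lia.
    by rewrite /=; field.
  have [->|an] := eqVneq a (4 * n)%N.
    have -> : (0 < 4 * n)%N by lia.
    by rewrite ltnn modnMr /=; field.
  have -> : (0 < a)%N by lia.
  have -> : (a < 4 * n)%N by lia.
  by case: ifP => _ /=; field.
rewrite (eq_bigr _ (fun a _ => wE a)) big_split /= big_split /=.
rewrite sum_mod4_weight -[X in _ + (X + _)]big_mkcond.
rewrite -[X in _ + (_ + X)]big_mkcond !(big_ord1_eq _ (fun=> 12^-1)) ltnSn /=.
by field.
Qed.

Theorem theorem3p2 (R : realType) (n : nat) (n_ge1 : (1 <= n)%N) :
  kirchhoff_index R (Q n) =
  (32 * n%:R ^+ 3 + 44 * n%:R ^+ 2 + 17 * n%:R + 2) / 3.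
Proof.
rewrite (kirchhoff_index_green R _ (@Q_connected n) _ _ (Q_green_laplacian R n)).
have -> : \sum_x Q_green R n x x = (5 * n%:R + 2) / 6.
  rewrite -sum_inv_odd_eigenvalue // sum_Q_vertex; apply: eq_bigr => a _.
  have d0 : (odd_eigenvalue n a)%:R != 0 :> R.
    by rewrite pnatr_eq0 -lt0n odd_eigenvalue_gt0.
  rewrite /Q_green /= subrr normr0 eqxx !expr0 !expr1 mulr1n.
  by field.
have -> : \sum_x \sum_y Q_green R n x y =
    - ((4 * n).+1%:R ^+ 3 - (4 * n).+1%:R) / 6.
  have row (x : Q n) : \sum_y Q_green R n x y =
      - (\sum_(a < (4 * n).+1) `|x.2%:R - a%:R|) / 4.
    rewrite sum_Q_vertex -sumrN mulr_suml; apply: eq_bigr => a _.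
    by rewrite /Q_green /= !expr0 !expr1; lra.
  rewrite sum_Q_vertex; under eq_bigr => a _ do rewrite !row /=.
  have := sum_distances R (4 * n).+1.
  set S := (X in X = _) => SE.
  rewrite (_ : \sum_(a < _) _ = - S / 2); last first.
    by rewrite -sumrN mulr_suml; apply: eq_bigr => a _; field.
  by rewrite SE; field.
by rewrite card_Q -natr1 natrD !natrM; field.
Qed.
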